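(* Let $(E,\|\cdot\|)$ be a complex normed space, and take $N\in\mathbb N$. Suppose that, for each $n\in\{1,\dots,N\}$, $\|\cdot\|_n$ is a norm on the space $E^n$ and, further, that $\|x\|_1=\|x\|$ for $x\in E$. Then the following are equivalent: (a) $(\|\cdot\|_n: 1\le n\le N)$ is a multi-norm of level $N$ on $\{E^n:1\le n\le N\}$; (b) $\|a\cdot x\|_m\le\|a\|\,\|x\|_n$ for each row-special matrix $a\in\mathbb M_{m,n}$, each $x\in E^n$, and each $m,n\in\{1,\dots,N\}$; (c) $\|a\cdot x\|_m\le\|a\|\,\|x\|_n$ for each $a\in\mathbb M_{m,n}$, each $x\in E^n$, and each $m,n\in\{1,\dots,N\}$.
   Context: $\mathbb M_{m,n}$ is the space of complex $m\times n$ matrices; $a=(a_{ij})\in\mathbb M_{m,n}$ acts as a map $E^n\to E^m$ by $(a\cdot x)_i=\sum_{j=1}^na_{ij}x_j$. Here $\|a\|=\|a:\ell_n^\infty\to\ell_m^\infty\|=\max_{1\le i\le m}\sum_{j=1}^n|a_{ij}|$. The matrix $a$ is row-special if each of its rows has at most one non-zero entry. A sequence $(\|\cdot\|_k:1\le k\le N)$, with $\|\cdot\|_k$ a norm on $E^k$ and $\|x\|_1=\|x\|$ for $x\in E$, is a multi-norm of level $N$ on $\{E^k:1\le k\le N\}$ if, for each $k$ with $2\le k\le N$: (A1) $\|(x_{\sigma(1)},\dots,x_{\sigma(k)})\|_k=\|(x_1,\dots,x_k)\|_k$ for each permutation $\sigma$ of $\{1,\dots,k\}$ and $x_1,\dots,x_k\in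 E$; (A2) $\|(\alpha_1x_1,\dots,\alpha_kx_k)\|_k\le(\max_i|\alpha_i|)\,\|(x_1,\dots,x_k)\|_k$ for $\alpha_1,\dots,\alpha_k\in\mathbb C$ and $x_1,\dots,x_k\in E$; (A3) $\|(x_1,\dots,x_{k-1},0)\|_k=\|(x_1,\dots,x_{k-1})\|_{k-1}$ for $x_1,\dots,x_{k-1}\in E$; (A4) $\|(x_1,\dots,x_{k-2},x_{k-1},x_{k-1})\|_k=\|(x_1,\dots,x_{k-2},x_{k-1})\|_{k-1}$ for $x_1,\dots,x_{k-1}\in E$. *)

(* Defs.v *)
From mathcomp Require Export all_boot all_order perm all_algebra.
From mathcomp Require Export complex.
From mathcomp Require Export all_classical all_reals all_analysis.
Export Order.TTheory GRing.Theory Num.Theory.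
Export ComplexField.Normc.
Export numFieldNormedType.Exports.

Set Implicit Arguments.
Unset Strict Implicit.
Unset Printing Implicit Defensive.

Local Open Scope classical_set_scope.
Local Open Scope ring_scope.
Local Open Scope complex_scope.

(* The complex numbers are R[i] with R : realType. The library norm on a
   normedModType R[i] takes its values in R[i]; the norms on the spaces E^k are
   real-valued here, and normc : R[i] -> R is the modulus. *)

Record is_norm (R : realType) (V : lmodType R[i]) (p : V -> R) : Prop := {
  is_norm_ge0 : forall x, 0 <= p x;
  is_norm_eq0 : forall x, p x = 0 -> x = 0;
  is_normZ : forall (c : R[i]) x, p (c *: x) = normc c * p x;
  is_normD : forall x y, p (x + y) <= p x + p y }.

Definition mx_act (R : realType) (E : lmodType R[i]) (m n : nat)
    (a : 'M[R[i]]_(m, n)) (x : {ffun 'I_n -> E}) : {ffun 'I_m -> E} :=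
  [ffun i => \sum_(j < n) a i j *: x j].

(* The norm of a as an operator from l^infty_n to l^infty_m: the library norm
   on column vectors is the maximum of the moduli of the entries. *)
Definition mx_opnorm (R : realType) (m n : nat) (a : 'M[R[i]]_(m, n)) : R :=
  sup [set r : R | exists2 x : 'cV[R[i]]_n, `|x| <= 1 & r%:C = `|a *m x|].

Definition row_special (R : realType) (m n : nat) (a : 'M[R[i]]_(m, n)) : Prop :=
  forall i, (#|[pred j | a i j != 0%R]| <= 1)%N.

Definition ffun_rcons (T : Type) (k : nat) (x : {ffun 'I_k -> T}) (y : T) :
    {ffun 'I_k.+1 -> T} :=
  [ffun i => if unlift ord_max i is Some j then x j else y].

Section MultiNorm.
Context {R : realType} {E : normedModType R[i]}.

(* Only the values nu k with 1 <= k <= N are constrained. *)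
Record norm_sequence (N : nat) (nu : forall k : nat, {ffun 'I_k -> E} -> R) :
    Prop := {
  norm_sequence_norm : forall k, (1 <= k <= N)%N -> is_norm (nu k);
  norm_sequence1 : forall x : E, (nu 1%N [ffun=> x])%:C = `|x| }.

(* A3 and A4 compare level k.+1 with level k, resp. level k.+2 with k.+1. *)
Record multi_norm (N : nat) (nu : forall k : nat, {ffun 'I_k -> E} -> R) :
    Prop := {
  multi_norm_seq : norm_sequence N nu;
  multi_normA1 : forall k, (2 <= k <= N)%N ->
    forall (s : 'S_k) (x : {ffun 'I_k -> E}),
      nu k [ffun i => x (s i)] = nu k x;
  multi_normA2 : forall k, (2 <= k <= N)%N ->
    forall (c : 'I_k -> R[i]) (x : {ffun 'I_k -> E}),
      nu k [ffun i => c i *: x i]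
        <= (\big[Num.max/0]_(i < k) normc (c i)) * nu k x;
  multi_normA3 : forall k, (2 <= k.+1 <= N)%N ->
    forall x : {ffun 'I_k -> E}, nu k.+1 (ffun_rcons x 0) = nu k x;
  multi_normA4 : forall k, (2 <= k.+2 <= N)%N ->
    forall x : {ffun 'I_k.+1 -> E},
      nu k.+2 (ffun_rcons x (x ord_max)) = nu k.+1 x }.

End MultiNorm.

Lemma normr_normc (R : realType) (z : R[i]) : `|z| = (normc z)%:C.
Proof. by case: z. Qed.

Lemma normc_ge0 (R : realType) (z : R[i]) : 0 <= normc z.
Proof. by rewrite -ler0c -normr_normc. Qed.

Lemma normc_real (R : realType) (r : R) : normc r%:C = `|r|.
Proof. by rewrite /normc /= expr0n addr0 sqrtr_sqr. Qed.

Lemma normc0_eq (R : realType) (z : R[i]) : (normc z == 0) = (z == 0).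
Proof. by apply/eqP/eqP => [/eq0_normc|->] //; exact: normc0. Qed.

Lemma normc_sum_le (R : realType) (I : finType) (F : I -> R[i]) :
  normc (\sum_i F i) <= \sum_i normc (F i).
Proof.
elim/big_ind2: _ => [|x1 x2 y1 y2 h1 h2|//]; first by rewrite normc0.
by rewrite (le_trans (le_normcD _ _)) ?lerD.
Qed.

Lemma mx_norm_leP (R : realType) n (x : 'cV[R[i]]_n) (M : R) : 0 <= M ->
  reflect (forall i, normc (x i 0) <= M) (`|x| <= M%:C).
Proof.
move=> M_ge0; have MC_ge0 : 0 <= M%:C by rewrite ler0c.
rewrite {1}/Num.norm /= mx_normE; apply: (iffP idP) => [xM i|xM].
  rewrite -lecR -normr_normc; apply: le_trans xM.
  rewrite -[leLHS]nngE num_le.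
  exact: (le_bigmax _ (fun ij : 'I_n * 'I_1 => `|x ij.1 ij.2|%:nng) (i, 0)).
elim/big_ind: _ => [//|u v hu hv|[i j] _ /=].
  by rewrite num_max /Order.max; case: ifP.
by rewrite ord1 normr_normc lecR.
Qed.

Lemma mx_opnormE (R : realType) (m n : nat) (a : 'M[R[i]]_(m, n)) :
  mx_opnorm a = \big[Num.max/0]_(i < m) \sum_(j < n) normc (a i j).
Proof.
rewrite /mx_opnorm; set M := RHS; set S := (X in sup X).
have M_ge0 : 0 <= M by exact: bigmax_ge_id.
have SM : ubound S M.
  move=> r [x x1 rE]; rewrite -lecR rE; apply/mx_norm_leP => // i.
  rewrite mxE (le_trans (normc_sum_le _))//.
  apply: (@le_trans _ _ (\sum_(j < n) normc (a i j))); last exact: le_bigmax.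
  apply: ler_sum => j _; rewrite normcM ler_piMr ?normc_ge0//.
  by move: j; apply/mx_norm_leP.
have S0 : S 0 by exists 0; rewrite ?mulmx0 normr0.
apply/eqP; rewrite eq_le ge_sup//=; last by exists 0.
apply: bigmax_le => [|i _]; first by apply: ub_le_sup => //; exists M.
pose x : 'cV[R[i]]_n :=
  \col_j (if a i j == 0 then 0 else (normc (a i j))%:C / a i j).
have x1 : `|x| <= 1.
  apply/(@mx_norm_leP _ _ x 1) => // j; rewrite mxE.
  case: eqVneq => [_|aij]; first by rewrite normc0.
  by rewrite normcM normcV normc_real ger0_norm ?normc_ge0// divff// normc0_eq.
have axE : (a *m x) i 0 = (\sum_j normc (a i j))%:C.
  rewrite mxE rmorph_sum; apply: eq_bigr => j _; rewrite mxE /=.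
  case: eqVneq => [->|aij]; first by rewrite mul0r normc0.
  by rewrite mulrCA divff// mulr1.
have [r rE] := elimT (complex_realP _) (normr_real (a *m x)).
apply: (@le_trans _ _ r); last by apply: ub_le_sup; [exists M|exists x].
have r_ge0 : 0 <= r by rewrite -ler0c -rE.
have : `|a *m x| <= r%:C by rewrite rE.
move/(mx_norm_leP _ r_ge0)/(_ i); rewrite axE.
by apply: le_trans; rewrite normc_real ler_norm.
Qed.

(* Main.v *)
(* Axioms A1, A3 and A4 say that the norm of a tuple depends only on its set of
   non-zero entries, and with A2 that it is monotone in this set; a row-special
   matrix merely selects entries and rescales them.  An arbitrary matrix [a] is
   a convex combination of row-special matrices of norm at most [mx_opnorm a],
   obtained by splitting one row at a time: a row [r] with sum of moduli [s] is
   the combination, with weights [|r_j| / s], of the rows whose only entry is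
   [s r_j / |r_j|] in column [j]. *)
Require Import Defs.

Set Implicit Arguments.
Unset Strict Implicit.
Unset Printing Implicit Defensive.

Local Open Scope ring_scope.
Local Open Scope complex_scope.

(** * Convex combinations under a norm *)

Section Norms.
Context {R : realType} {V : lmodType R[i]} (p : V -> R) (pP : is_norm p).

Lemma is_norm0 : p 0 = 0.
Proof. by rewrite -(scale0r 0) is_normZ// normc0 mul0r. Qed.

Lemma is_norm_sum_scale n (t : 'I_n -> R) (v : 'I_n -> V) (M : R) :
  (forall j, 0 <= t j) -> \sum_j t j = 1 -> (forall j, p (v j) <= M) ->
  p (\sum_j (t j)%:C *: v j) <= M.
Proof.
move=> t0 t1 vM; rewrite -[M]mul1r -t1 mulr_suml.
elim/big_ind2: _ => [|x a y b xa yb|j _]; first by rewrite is_norm0.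
  by rewrite (le_trans (is_normD pP _ _))// lerD.
by rewrite is_normZ// normc_real ger0_norm// ler_wpM2l.
Qed.

End Norms.

(** * Consequences of the axioms, for tuples seen as lists *)

Section Sequences.
Context {R : realType} {E : normedModType R[i]}.
Variables (N : nat) (nu : forall k : nat, {ffun 'I_k -> E} -> R).
Arguments nu : clear implicits.
Hypothesis nuP : multi_norm N nu.

Let normP k : (0 < k <= N)%N -> is_norm (nu k) :=
  @norm_sequence_norm _ _ _ _ (multi_norm_seq nuP) k.

(** Lists free the level from the type: permutation, [undup] and concatenation can be used without
    casts between the spaces E^k. *)
Definition seq_norm (s : seq E) : R := nu (size s) [ffun i : 'I_(size s) => s`_i].

Lemma seq_normE n (s : seq E) :
  size s = n -> seq_norm s = nu n [ffun i : 'I_n => s`_i].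
Proof. by move<-. Qed.

Lemma seq_norm_codom n (x : {ffun 'I_n -> E}) : seq_norm (codom x) = nu n x.
Proof.
rewrite (@seq_normE n) ?size_codom ?card_ord//; congr nu; apply/ffunP => i.
by rewrite ffunE (nth_map i) ?size_enum_ord// nth_ord_enum.
Qed.

Lemma seq_norm_perm (s t : seq E) :
  (size s <= N)%N -> perm_eq s t -> seq_norm s = seq_norm t.
Proof.
move=> sN st; have szE := perm_size st.
(* A1 starts at level 2; below it, lists that are permutations of each other are equal. *)
have [t1|t1] := leqP (size t) 1.
  case: t t1 st {szE} => [|x [|//]] _ st; first by rewrite (perm_nilP st).
  by rewrite (perm_small_eq _ st).
have /tuple_permP[q sE] : perm_eq s (in_tuple t) by [].
have tN : (2 <= size t <= N)%N by rewrite t1 -szE.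
rewrite (seq_normE szE) -[RHS](multi_normA1 nuP tN q).
congr nu; apply/ffunP => i; rewrite !ffunE sE.
by rewrite nth_mktuple (tnth_nth 0).
Qed.

Lemma ffun_rcons_nth (s : seq E) (y : E) :
  ffun_rcons [ffun i : 'I_(size s) => s`_i] y =
  [ffun i : 'I_(size s).+1 => (rcons s y)`_i].
Proof.
apply/ffunP => i; rewrite !ffunE nth_rcons; case: unliftP => [j|] ->.
  by rewrite ffunE lift_max ltn_ord.
by rewrite /= ltnn eqxx.
Qed.

Lemma seq_norm_rcons0 (s : seq E) :
  (0 < size s)%N -> (size s < N)%N -> seq_norm (rcons s 0) = seq_norm s.
Proof.
move=> s0 sN; rewrite (@seq_normE (size s).+1) ?size_rcons//.
by rewrite -ffun_rcons_nth (multi_normA3 nuP)// ltnS s0.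
Qed.

Lemma seq_norm_cat_nseq0 (s : seq E) n :
  (0 < size s)%N -> (size s + n <= N)%N -> seq_norm (s ++ nseq n 0) = seq_norm s.
Proof.
elim: n s => [|n IHn] s s0 sN; first by rewrite cats0.
have sN' : (size s < N)%N by rewrite (leq_trans _ sN)// addnS ltnS leq_addr.
by rewrite -cat_rcons IHn ?size_rcons// ?addSnnS// seq_norm_rcons0.
Qed.

(** A4 repeats the last entry only; A1 carries the repetition to the front. *)
Lemma seq_norm_dup (x : E) (s : seq E) :
  ((size s).+2 <= N)%N -> seq_norm (x :: x :: s) = seq_norm (x :: s).
Proof.
move=> sN; rewrite (@seq_norm_perm _ (rcons (rcons s x) x))//; last first.
  by rewrite perm_sym perm_rcons perm_cons perm_rcons.
rewrite (@seq_norm_perm (x :: s) (rcons s x)) ?(ltnW sN)//; last first.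
  by rewrite perm_sym perm_rcons.
rewrite (@seq_normE (size s).+2) ?size_rcons//.
rewrite (@seq_normE (size s).+1) ?size_rcons//.
rewrite -[RHS](multi_normA4 nuP) ?sN//; congr nu; apply/ffunP => i.
rewrite !ffunE nth_rcons size_rcons; case: unliftP => [j|] ->.
  by rewrite ffunE lift_max ltn_ord.
by rewrite /= ltnn eqxx nth_rcons ltnn eqxx.
Qed.

Lemma seq_norm_cons_mem (x : E) (s : seq E) :
  (size s < N)%N -> x \in s -> seq_norm (x :: s) = seq_norm s.
Proof.
move=> sN xs; have sP := perm_to_rem xs.
rewrite (seq_norm_perm (ltnW sN) sP) (@seq_norm_perm (x :: s) [:: x, x & rem x s])//.
  by rewrite seq_norm_dup// -[(size _).+1]/(size (x :: rem x s)) -(perm_size sP).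
by rewrite perm_cons.
Qed.

(** The prefix [s] makes the induction on [t] go through: an entry kept by [undup] moves to the end
    of [s], and one that recurs later in [t] is brought to the front and absorbed there. *)
Lemma seq_norm_cat_undup (s t : seq E) :
  (size s + size t <= N)%N -> seq_norm (s ++ t) = seq_norm (s ++ undup t).
Proof.
elim: t s => [//|x t IHt] s /=; rewrite addnS => stN.
case: ifP => xt; last by rewrite -!cat_rcons IHt// size_rcons addSn.
rewrite -IHt 1?ltnW// (@seq_norm_perm _ (x :: s ++ t)) ?seq_norm_cons_mem//.
- by rewrite size_cat.
- by rewrite mem_cat xt orbT.
- by rewrite size_cat addnS.
- by rewrite -(cat1s x t) perm_catCA.
Qed.

Lemma seq_norm_undup (s : seq E) :
  (size s <= N)%N -> seq_norm s = seq_norm (undup s).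
Proof. exact: (@seq_norm_cat_undup [::]). Qed.

(** By A3, padding with zeros lifts [s] to the level of [s ++ t]; the padded list is [s ++ t] with
    its tail multiplied by 0, so A2 applies. *)
Lemma seq_norm_cat (s t : seq E) :
  (0 < size s)%N -> (size s + size t <= N)%N -> seq_norm s <= seq_norm (s ++ t).
Proof.
move=> s0 stN; rewrite -(seq_norm_cat_nseq0 s0 stN).
have [->//|t0] := eqVneq t [::].
have {}t0 : (0 < size t)%N by rewrite lt0n size_eq0.
set n := (size s + size t)%N in stN *.
have n2 : (2 <= n <= N)%N by rewrite stN (leq_add s0 t0).
have nE : size (s ++ t) = n by rewrite size_cat.
rewrite (seq_normE nE) (@seq_normE n) ?size_cat ?size_nseq//.
pose c (i : 'I_n) : R[i] := (i < size s)%N%:R.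
have -> : [ffun i : 'I_n => (s ++ nseq (size t) 0)`_i]
    = [ffun i => c i *: [ffun i : 'I_n => (s ++ t)`_i] i].
  apply/ffunP => i; rewrite !ffunE /c !nth_cat; case: ifP => _.
    by rewrite scale1r.
  by rewrite scale0r nth_nseq if_same.
rewrite (le_trans (multi_normA2 nuP n2 _ _))// ler_piMl//.
  by apply: is_norm_ge0; apply: normP; case/andP: n2 => /ltnW-> ->.
apply: bigmax_le => // i _; rewrite /c; case: (i < _)%N.
  by rewrite normc1.
by rewrite normc0.
Qed.

(** Once duplicates are removed, [t] is a permutation of [s] followed by the entries of [t] outside
    [s]. Non-emptiness of [s] keeps away from level 0, where nothing is assumed. *)
Lemma seq_norm_sub (s t : seq E) :
  (0 < size s <= N)%N -> (size t <= N)%N -> {subset s <= t} ->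
  seq_norm s <= seq_norm t.
Proof.
move=> /andP[s0 sN] tN st; rewrite (seq_norm_undup sN) (seq_norm_undup tN).
pose r := [seq y <- undup t | y \notin s].
have tE : perm_eq (undup t) (undup s ++ r).
  apply: uniq_perm; rewrite ?undup_uniq//.
    rewrite cat_uniq !undup_uniq filter_uniq ?undup_uniq// andbT/=.
    by apply/hasPn => y; rewrite mem_filter => /andP[ys _]; rewrite /= mem_undup.
  move=> y; rewrite mem_cat mem_filter !mem_undup.
  by have [/st->//|] := boolP (y \in s).
have tN' := leq_trans (size_undup t) tN.
rewrite (seq_norm_perm tN' tE) seq_norm_cat//; last first.
  by rewrite -size_cat -(perm_size tE).
by rewrite !lt0n !size_eq0 in s0 *; apply: contra s0 => /eqP/undup_nil->.
Qed.

Lemma multi_norm_comp m n (f : 'I_m -> 'I_n) (x : {ffun 'I_n -> E}) :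
  (0 < m <= N)%N -> (n <= N)%N -> nu m [ffun i => x (f i)] <= nu n x.
Proof.
move=> mN nN; rewrite -!seq_norm_codom seq_norm_sub ?size_codom ?card_ord//.
by move=> _ /codomP[i ->]; rewrite ffunE codom_f.
Qed.

Lemma multi_norm_scale m (c : 'I_m -> R[i]) (x : {ffun 'I_m -> E}) :
  (0 < m <= N)%N ->
  nu m [ffun i => c i *: x i] <= (\big[Num.max/0]_(i < m) normc (c i)) * nu m x.
Proof.
(* A2 starts at level 2; at level 1 the bound is homogeneity of the norm. *)
case: m c x => [//|[|m]] c x mN; last exact: (multi_normA2 nuP).
have -> : [ffun i => c i *: x i] = c ord0 *: x.
  by apply/ffunP => i; rewrite !ffunE ord1.
rewrite is_normZ; last exact: normP.
rewrite ler_wpM2r ?(is_norm_ge0 (normP mN))//.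
exact: (le_bigmax _ (fun i => normc (c i))).
Qed.

End Sequences.

(** * Matrices: operator norm, splitting of rows, reindexing *)

Section Matrices.
Context {R : realType}.

Lemma mx_opnorm_ge0 m n (a : 'M[R[i]]_(m, n)) : 0 <= mx_opnorm a.
Proof. by rewrite mx_opnormE bigmax_ge_id. Qed.

Lemma row_sum_le_opnorm m n (a : 'M[R[i]]_(m, n)) i :
  \sum_j normc (a i j) <= mx_opnorm a.
Proof.
by rewrite mx_opnormE (le_bigmax _ (fun i => \sum_j normc (a i j))).
Qed.

Lemma mx_opnorm_le m n (a : 'M[R[i]]_(m, n)) (M : R) :
  0 <= M -> (forall i, \sum_j normc (a i j) <= M) -> mx_opnorm a <= M.
Proof. by move=> M0 aM; rewrite mx_opnormE; apply: bigmax_le. Qed.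

Lemma normc_le_opnorm m n (a : 'M[R[i]]_(m, n)) i j :
  normc (a i j) <= mx_opnorm a.
Proof.
apply: le_trans (row_sum_le_opnorm a i).
by rewrite (bigD1 j)//= lerDl sumr_ge0// => k _; exact: normc_ge0.
Qed.

Lemma row_convex n (r : 'I_n -> R[i]) : (0 < n)%N ->
  exists (t : 'I_n -> R) (b : 'I_n -> R[i]),
    [/\ forall j, 0 <= t j, \sum_j t j = 1, forall j, r j = (t j)%:C * b j
      & forall j, normc (b j) <= \sum_k normc (r k)].
Proof.
move=> n0; set s := \sum_k _.
have s0 : 0 <= s by apply: sumr_ge0 => k _; exact: normc_ge0.
have [sE|s_neq0] := eqVneq s 0.
  (* The row is zero here: all the weight goes to one column, which exists since [n] is positive. *)
  exists (fun j => (j == Ordinal n0)%:R), (fun=> 0); split=> //.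
  - by rewrite (bigD1 (Ordinal n0))//= ?eqxx big1 ?addr0// => j /negPf->.
  - move=> j; rewrite mulr0; apply/eqP; rewrite -normc0_eq; apply/eqP.
    by apply: (psumr_eq0P _ sE) => // k _; exact: normc_ge0.
  - by move=> j; rewrite normc0.
(* Where [r j] vanishes, the convention 0 / 0 = 0 makes the entry 0, so the modulus bound still
   holds. *)
exists (fun j => normc (r j) / s), (fun j => s%:C * (r j / (normc (r j))%:C)).
split=> [j||j|j].
- by rewrite divr_ge0 ?normc_ge0.
- by rewrite -mulr_suml divff.
- have [->|rj] := eqVneq (r j) 0; first by rewrite normc0 !mul0r.
  have sC : s%:C != 0 by rewrite -normc0_eq normc_real normr_eq0.
  have rC : (normc (r j))%:C != 0.
    by rewrite -normc0_eq normc_real normr_eq0 normc0_eq.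
  rewrite rmorphM fmorphV /= mulrA divfK// mulrCA divff// mulr1//.
- rewrite !normcM normcV !normc_real !ger0_norm ?normc_ge0//.
  have [->|rj] := eqVneq (r j) 0; first by rewrite normc0 mul0r mulr0.
  by rewrite divff ?mulr1// normc0_eq.
Qed.

Variable E : normedModType R[i].

(** The row bound [M] is kept separate from [a] so that it passes unchanged to every matrix met
    during the splitting. *)
Lemma mx_act_convex m n (a : 'M[R[i]]_(m, n)) (x : {ffun 'I_n -> E})
    (p : {ffun 'I_m -> E} -> R) (M C : R) :
  is_norm p -> (0 < n)%N -> (forall i, \sum_j normc (a i j) <= M) ->
  (forall b : 'M[R[i]]_(m, n), row_special b ->
    (forall i, \sum_j normc (b i j) <= M) -> p (mx_act b x) <= C) ->
  p (mx_act a x) <= C.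
Proof.
move=> pP n0 aM pC.
(* Induction on [k], where only the rows of index below [k] remain to be split. *)
suff gen k (b : 'M[R[i]]_(m, n)) : (forall i, \sum_j normc (b i j) <= M) ->
    (forall i : 'I_m, (k <= i)%N -> (#|[pred j | b i j != 0%R]| <= 1)%N) ->
    p (mx_act b x) <= C.
  by apply: (gen m) => // i; rewrite leqNgt ltn_ord.
elim: k b => [|k IHk] b bM bk; first by apply: pC => // i; exact: bk.
have [km|mk] := ltnP k m; last first.
  by apply: IHk => // i ki; have := leq_trans mk ki; rewrite leqNgt ltn_ord.
pose i0 := Ordinal km.
have [t [c [t0 t1 bE cM]]] := row_convex (b i0) n0.
(* Row [i0] of [b] is the mean, with weights [t], of the rows [i0] of the [d l]; the other rows are
   common to all [d l] and survive because the weights sum to 1. *)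
pose d l := \matrix_(i, j) if i == i0 then (if j == l then c l else 0) else b i j.
have -> : mx_act b x = \sum_l (t l)%:C *: mx_act (d l) x.
  apply/ffunP => i; rewrite sum_ffunE ffunE.
  under [RHS]eq_bigr do rewrite !ffunE.
  have [->|ii0] := eqVneq i i0.
    apply: eq_bigr => l _; rewrite (bigD1 l)//= mxE !eqxx big1 ?addr0.
      by rewrite scalerA -bE.
    by move=> j /negPf jl; rewrite mxE eqxx jl scale0r.
  under [RHS]eq_bigr => l _.
    under eq_bigr do rewrite mxE (negPf ii0).
    over.
  by rewrite -scaler_suml -rmorph_sum t1 scale1r.
apply: is_norm_sum_scale => // l; apply: IHk => i.
  have [->|ii0] := eqVneq i i0.
    rewrite (bigD1 l)//= mxE !eqxx big1 ?addr0.
      exact: le_trans (bM i0).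
    by move=> j /negPf jl; rewrite mxE eqxx jl normc0.
  by under eq_bigr do rewrite mxE (negPf ii0).
have [->|ii0 ki] := eqVneq i i0.
  move=> _; rewrite -(card1 l) subset_leq_card//; apply/fintype.subsetP => j.
  by rewrite !inE mxE eqxx; case: (j == l); rewrite ?eqxx.
rewrite (eq_card (B := [pred j | b i j != 0])) ?bk//.
  by rewrite ltn_neqAle ki andbT eq_sym.
by move=> j; rewrite !inE mxE (negPf ii0).
Qed.

Lemma mx_act_row_special m n (a : 'M[R[i]]_(m, n)) (x : {ffun 'I_n -> E}) :
  (0 < n)%N -> row_special a -> exists f : 'I_m -> 'I_n,
    mx_act a x = [ffun i => a i (f i) *: [ffun i => x (f i)] i].
Proof.
(* A zero row gets an arbitrary column, which is harmless since its coefficient [a i (f i)] is then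
   0. *)
move=> n0 aS; exists (fun i => odflt (Ordinal n0) [pick j | a i j != 0]).
apply/ffunP => i; rewrite !ffunE; case: pickP => [j aij|a0] /=.
  rewrite (bigD1 j)//= big1 ?addr0// => k kj.
  have [->|aik] := eqVneq (a i k) 0; first by rewrite scale0r.
  by have /card_le1_eqP/(_ k j aik aij) kjE := aS i; rewrite kjE eqxx in kj.
rewrite big1 => [|j _]; last by rewrite (eqP (negbFE (a0 j))) scale0r.
by rewrite (eqP (negbFE (a0 (Ordinal n0)))) scale0r.
Qed.

(** Every operation in the axioms has this form: select an entry, or zero coded by [None], then
    rescale. The matrix has at most the one entry [c i] in row [i], whence the norm bound. *)
Lemma mx_act_reindex m n (f : 'I_m -> option 'I_n) (c : 'I_m -> R[i])
    (x : {ffun 'I_n -> E}) :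
  exists2 a : 'M[R[i]]_(m, n),
    mx_opnorm a <= \big[Num.max/0]_(i < m) normc (c i)
    & mx_act a x = [ffun i => c i *: oapp x 0 (f i)].
Proof.
exists (\matrix_(i, j) if f i == Some j then c i else 0).
  apply: mx_opnorm_le => [|i]; first exact: bigmax_ge_id.
  apply: (@le_trans _ _ (normc (c i))); last first.
    exact: (le_bigmax _ (fun i => normc (c i))).
  case fi: (f i) => [j|]; last first.
    by rewrite big1 ?normc_ge0// => j _; rewrite mxE fi normc0.
  rewrite (bigD1 j)//= big1 => [|k kj]; first by rewrite addr0 mxE fi eqxx.
  by rewrite mxE fi -[_ == _]/(j == k) eq_sym (negPf kj) normc0.
apply/ffunP => i; rewrite !ffunE; case fi: (f i) => [j|] /=.
  rewrite (bigD1 j)//= big1 => [|k kj]; first by rewrite addr0 mxE fi eqxx.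
  by rewrite mxE fi -[_ == _]/(j == k) eq_sym (negPf kj) scale0r.
by rewrite big1 ?scaler0// => j _; rewrite mxE fi scale0r.
Qed.

End Matrices.

(** * From the matrix bound back to the axioms *)

Section MatrixBound.
Context {R : realType} {E : normedModType R[i]}.
Variables (N : nat) (nu : forall k : nat, {ffun 'I_k -> E} -> R).
Arguments nu : clear implicits.
Hypothesis nuP : norm_sequence N nu.
Hypothesis nu_act : forall m n : nat, (1 <= m <= N)%N -> (1 <= n <= N)%N ->
  forall (a : 'M[R[i]]_(m, n)) (x : {ffun 'I_n -> E}),
    nu m (mx_act a x) <= mx_opnorm a * nu n x.

Lemma nu_reindex_scale m n (f : 'I_m -> option 'I_n) (c : 'I_m -> R[i])
    (x : {ffun 'I_n -> E}) : (1 <= m <= N)%N -> (1 <= n <= N)%N ->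
  nu m [ffun i => c i *: oapp x 0 (f i)]
    <= (\big[Num.max/0]_(i < m) normc (c i)) * nu n x.
Proof.
move=> mN nN; have [a aM <-] := mx_act_reindex f c x.
rewrite (le_trans (nu_act mN nN _ _))// ler_wpM2r//.
exact: is_norm_ge0 (norm_sequence_norm nuP nN) _.
Qed.

Lemma nu_reindex m n (f : 'I_m -> option 'I_n)
    (x : {ffun 'I_n -> E}) (y : {ffun 'I_m -> E}) :
  (1 <= m <= N)%N -> (1 <= n <= N)%N ->
  (forall i, y i = oapp x 0 (f i)) -> nu m y <= nu n x.
Proof.
move=> mN nN yE.
have -> : y = [ffun i => 1 *: oapp x 0 (f i)].
  by apply/ffunP => i; rewrite ffunE scale1r.
rewrite (le_trans (nu_reindex_scale _ _ _ mN nN))// ler_piMl//.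
  exact: is_norm_ge0 (norm_sequence_norm nuP nN) _.
by apply: bigmax_le => // i _; rewrite normc1.
Qed.

(** In each of A1, A3 and A4 either tuple is a reindexing of the other, so the equality is two
    inequalities; A2 is the bound for a diagonal matrix. *)
Lemma multi_norm_of_mx_bound : multi_norm N nu.
Proof.
split=> // k /andP[k2 kN].
- have k1N : (1 <= k <= N)%N by rewrite ltnW.
  move=> s x; apply/le_anti/andP; split.
    by apply: (nu_reindex (f := fun i => Some (s i))) => // i; rewrite ffunE.
  apply: (nu_reindex (f := fun i => Some ((s^-1)%g i))) => // i.
  by rewrite /= ffunE permKV.
- have k1N : (1 <= k <= N)%N by rewrite ltnW.
  by move=> c x; apply: (nu_reindex_scale Some).
- have kN' : (1 <= k <= N)%N by rewrite -ltnS k2 ltnW.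
  move=> x; apply/le_anti/andP; split.
    (* [unlift ord_max] is [None] exactly at the appended position, which therefore receives 0. *)
    apply: (nu_reindex (f := unlift ord_max)) => // i; rewrite ffunE.
    by case: unlift.
  apply: (nu_reindex (f := fun i => Some (lift ord_max i))) => // i.
  by rewrite /= ffunE liftK.
- have kN' : (1 <= k.+1 <= N)%N := ltnW kN.
  move=> x; apply/le_anti/andP; split.
    (* The default [ord_max] makes the appended position read the last entry of [x] once more. *)
    apply: (nu_reindex (f := fun i => Some (odflt ord_max (unlift ord_max i))))
      => // i; rewrite ffunE.
    by case: unlift.
  apply: (nu_reindex (f := fun i => Some (lift ord_max i))) => // i.
  by rewrite /= ffunE liftK.
Qed.

End MatrixBound.

Theorem theorem2p35 (R : realType) (E : normedModType R[i]) (N : nat)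
    (N_gt0 : (0 < N)%N) (nu : forall k : nat, {ffun 'I_k -> E} -> R)
    (nuP : norm_sequence N nu) :
  [<-> multi_norm N nu;
       forall m n : nat, (1 <= m <= N)%N -> (1 <= n <= N)%N ->
         forall a : 'M[R[i]]_(m, n), row_special a ->
         forall x : {ffun 'I_n -> E},
           nu m (mx_act a x) <= mx_opnorm a * nu n x;
       forall m n : nat, (1 <= m <= N)%N -> (1 <= n <= N)%N ->
         forall (a : 'M[R[i]]_(m, n)) (x : {ffun 'I_n -> E}),
           nu m (mx_act a x) <= mx_opnorm a * nu n x].
Proof.
tfae.
- move=> mnP m n mN nN a aS x; have [n0 nN'] := andP nN.
  have nu0 k y (kN : (1 <= k <= N)%N) : 0 <= nu k y.
    exact: is_norm_ge0 (norm_sequence_norm nuP kN) _.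
  have [f ->] := mx_act_row_special x n0 aS.
  apply: le_trans (multi_norm_scale mnP _ _ mN) _.
  (* The scalars are bounded by the operator norm, the selected tuple by [nu n x]. *)
  apply: ler_pM; rewrite ?bigmax_ge_id ?nu0//.
    apply: bigmax_le => [|i _]; first exact: mx_opnorm_ge0.
    exact: normc_le_opnorm.
  exact: (multi_norm_comp mnP).
- move=> nu_special m n mN nN a x; have [n0 _] := andP nN.
  (* With this row bound every row-special [b] of the splitting has norm at most [mx_opnorm a], so
     all of them share the bound wanted for [a]. *)
  apply: (mx_act_convex (M := mx_opnorm a)) => // [||b bS bM].
  + exact: norm_sequence_norm nuP _ mN.
  + exact: row_sum_le_opnorm.
  + rewrite (le_trans (nu_special _ _ mN nN _ bS x))// ler_wpM2r//.
      exact: is_norm_ge0 (norm_sequence_norm nuP nN) _.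
    by apply: mx_opnorm_le => //; exact: mx_opnorm_ge0.
- exact: multi_norm_of_mx_bound.
Qed.
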